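(* Let $M$ be a manifold, let $F_1,\dots,F_n$ ($n\ge1$) be conic Finsler metrics on $M$ with conic domains $A_1,\dots,A_n$ and fundamental tensors $g^1,\dots,g^n$, such that $A=\bigcap_{k=1}^nA_k$ satisfies $\pi(A)=M$, and let $\beta_{n+1},\dots,\beta_{n+m}$ be one-forms on $M$. Let $B$ be a conic open subset of $\mathbb R^{n+m}$ and $L:B\times M\to\mathbb R$ a continuous function such that (a) $L$ is smooth and positive on $(B\times M)\setminus(\{0\}\times M)$; (b) $L(\lambda x,p)=\lambda^2L(x,p)$ for all $\lambda>0$ and $(x,p)\in B\times M$. Assume that for every $v\in A$ the point $$(\ast)\qquad (F_1(v),\dots,F_n(v),\beta_{n+1}(v),\dots,\beta_{n+m}(v),\pi(v))$$ belongs to $B\times M$, and let $F^2:A\to\mathbb R$ be the function whose value at $v$ is $L$ evaluated at the point $(\ast)$. Then $F:=\sqrt{F^2}$ is a conic pseudo-Finsler metric with domain $A$ and its fundamental tensor $g$ satisfies $$g_v(w,w)=\frac12\sum_{k=1}^n\frac{L_{,k}}{F_k(v)}h^k_v(w,w)+\frac12P(v,w)\,\mathrm{Hess}(L)\,P(v,w)^T$$ for all $v\in A\setminus 0$ and $w\in T_{\pi(v)}M$, where $^T$ denotes transpose, $$P(v,w)=\Big(\frac{g^1_v(v,w)}{F_1(v)},\dots,\frac{g^n_v(v,w)}{F_n(v)},\beta_{n+1}(w),\dots,\beta_{n+m}(w)\Big)\in\mathbb R^{n+m},$$ and the derivatives of $L$ are computed at the point $(\ast)$. Moreover, $g$ is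 positive semi-definite if the following conditions hold at the points $(\ast)$ obtained by taking any $v\in A\setminus0$: (A) $L_{,k}\ge0$ for every $k=1,\dots,n$, and (B) $\mathrm{Hess}(L)$ is positive semi-definite, and $g$ is positive definite (i.e. $F$ is a conic Finsler metric) if, additionally, at these points: (C) $L_{,1}+\dots+L_{,n}>0$.
   Context: Let $\pi:TM\to M$ be the natural projection. A conic pseudo-Finsler metric on $M$ with (conic) domain $A$ is a continuous function $F:A\to[0,\infty)$, where $A\subset TM$ is open with $\pi(A)=M$ and conic ($v\in A$, $\lambda>0$ imply $\lambda v\in A$), which is smooth on $A$ except at most at the zero vectors, with $F(v)=0$ iff $v$ is a zero vector and $F(\lambda v)=\lambda F(v)$ for $\lambda>0$, $v\in A$. Its fundamental tensor is $g_v(u,w)=\frac12\frac{\partial^2}{\partial t\partial s}F(v+tu+sw)^2|_{t=s=0}$ for $v\in A\setminus0$ (nonzero vectors of $A$), $u,w\in T_{\pi(v)}M$. It is a conic Finsler metric if $g_v$ is positive definite for all $v\in A\setminus0$. The angular metric of $F_k$ is $h^k_v(w,w)=g^k_v(w,w)-\frac{1}{F_k(v)^2}g^k_v(v,w)^2$. An open subset $B\subset\mathbb R^{n+m}$ is conic if $x\in B$, $\lambda>0$ imply $\lambda x\in B$. $L_{,r}$ and $L_{,rs}$ denote first and second partial derivatives of $L$ with respect to the $r$-th, and $r$-th and $s$-th, coordinates of $\mathbb R^{n+m}$, and $\mathrm{Hess}(L)$ is the $(n+m)\times(n+m)$ matrix $(L_{,rs})$. *)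

(* Defs.v *)
From HB Require Import structures.
From mathcomp Require Import all_boot all_order all_algebra.
From mathcomp Require Import all_classical all_reals all_analysis.
Set Implicit Arguments.
Unset Strict Implicit.
Unset Printing Implicit Defensive.
Import Order.TTheory GRing.Theory Num.Theory.
Import numFieldNormedType.Exports.
Local Open Scope classical_set_scope.
Local Open Scope ring_scope.

(* Meant for open [U] and finite-dimensional [V], where it is the usual C^k
   condition: the values of [f] outside [U] are then irrelevant. *)
Fixpoint Ck_on (R : realType) (V W : normedModType R) (k : nat) (U : set V)
    (f : V -> W) : Prop :=
  match k with
  | 0%N => forall x, U x -> {for x, continuous f}
  | k'.+1 => (forall x, U x -> differentiable f x) /\
             (forall v : V, Ck_on k' U ('D_v f))
  end.

Definition smooth_on (R : realType) (V W : normedModType R) (U : set V)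
    (f : V -> W) : Prop := forall k, Ck_on k U f.

(* A d-dimensional smooth manifold with a (not necessarily maximal) atlas
   indexed by [chart_idx].  [coord i] is only relevant on [chart_dom i] and
   [coord_inv i] only on the image of [chart_dom i].  [chart_at] selects, with
   no continuity requirement, one chart of the atlas around every point. *)
Record manifold (R : realType) (d : nat) := Manifold {
  pt :> topologicalType;
  chart_idx : Type;
  chart_dom : chart_idx -> set pt;
  coord : chart_idx -> pt -> 'rV[R]_d;
  coord_inv : chart_idx -> 'rV[R]_d -> pt;
  chart_at : pt -> chart_idx;
  manifold_hausdorff : hausdorff_space pt;
  manifold_second_countable : @second_countable pt;
  chart_dom_open : forall i, open (chart_dom i);
  chart_img_open : forall i, open (coord i @` chart_dom i);
  coord_continuous : forall i, {within chart_dom i, continuous (coord i)};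
  coord_inv_continuous : forall i,
    {within coord i @` chart_dom i, continuous (coord_inv i)};
  coordK : forall i, {in chart_dom i, cancel (coord i) (coord_inv i)};
  chart_at_dom : forall p, chart_dom (chart_at p) p;
  transition_smooth : forall i j,
    smooth_on (coord i @` (chart_dom i `&` chart_dom j))
              (coord j \o coord_inv i)
}.

Section Tangent.
Variables (R : realType) (d : nat) (M : manifold R d).

Definition chart_img (i : chart_idx M) : set 'rV[R]_d :=
  coord i @` chart_dom i.

(* [TVec p v] is the tangent vector at [p] whose components in the chart
   [chart_at p] are [v]; so T_pM is identified with R^d, and this identification
   is linear.  A record is used rather than [M * 'rV_d] because the product
   topology is in general not the topology of TM. *)
Record tangent_bundle := TVec { tproj : M; tvec : 'rV[R]_d }.

(* The parametrization of TM induced by the chart [i]: [(y, u)] is sent to the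
   vector at [coord_inv i y] with components [u] in the chart [i]. *)
Definition tchart_inv (i : chart_idx M) (z : 'rV[R]_d * 'rV[R]_d) :
    tangent_bundle :=
  let p := coord_inv i z.1 in
  TVec p ('D_(z.2) (coord (chart_at p) \o coord_inv i) z.1).

Definition tcoords (i : chart_idx M) (S : set tangent_bundle) :
    set ('rV[R]_d * 'rV[R]_d) :=
  [set z | chart_img i z.1 /\ S (tchart_inv i z)].

Definition tangent_open (S : set tangent_bundle) : Prop :=
  forall i, open (tcoords i S).

(* The next two notions are meant for open [S]. *)
Definition tangent_continuous_on (S : set tangent_bundle)
    (f : tangent_bundle -> R) : Prop :=
  forall i z, tcoords i S z -> {for z, continuous (f \o tchart_inv i)}.

Definition tangent_smooth_on (S : set tangent_bundle)
    (f : tangent_bundle -> R) : Prop :=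
  forall i, smooth_on (tcoords i S) (f \o tchart_inv i : _ -> R^o).

Definition nonzero_part (A : set tangent_bundle) : set tangent_bundle :=
  [set v | A v /\ tvec v <> 0].

(* Smoothness of a one-form: its components in every chart are smooth. *)
Definition one_form (b : tangent_bundle -> R) : Prop :=
  (forall p : M, scalar (fun v => b (TVec p v))) /\
  (forall i (k : 'I_d),
    smooth_on (chart_img i)
      (fun y => b (tchart_inv i (y, delta_mx 0 k)) : R^o)).

Definition conic_dom (A : set tangent_bundle) : Prop :=
  forall (p : M) v (l : R), A (TVec p v) -> 0 < l -> A (TVec p (l *: v)).

Record conic_pseudo_finsler (A : set tangent_bundle) (F : tangent_bundle -> R) :
    Prop := ConicPseudoFinsler {
  cpf_open : tangent_open A;
  cpf_proj : tproj @` A = setT;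
  cpf_conic : conic_dom A;
  cpf_continuous : tangent_continuous_on A F;
  cpf_ge0 : forall v, A v -> 0 <= F v;
  cpf_smooth : tangent_smooth_on (nonzero_part A) F;
  cpf_eq0 : forall v, A v -> (F v = 0 <-> tvec v = 0);
  cpf_homo : forall (p : M) v (l : R), A (TVec p v) -> 0 < l ->
    F (TVec p (l *: v)) = l * F (TVec p v)
}.

Definition fundamental_tensor (F : tangent_bundle -> R) (p : M)
    (v u w : 'rV[R]_d) : R :=
  2^-1 * derive1 (fun t : R => derive1 (fun s : R =>
     F (TVec p (v + t *: u + s *: w)) ^+ 2 : R^o) 0 : R^o) 0.

Definition fundamental_posdef (A : set tangent_bundle) (F : tangent_bundle -> R) :
    Prop :=
  forall (p : M) v, A (TVec p v) -> v <> 0 ->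
  forall w, w <> 0 -> 0 < fundamental_tensor F p v w w.

Definition fundamental_possemidef (A : set tangent_bundle)
    (F : tangent_bundle -> R) : Prop :=
  forall (p : M) v, A (TVec p v) -> v <> 0 ->
  forall w, 0 <= fundamental_tensor F p v w w.

Definition conic_finsler (A : set tangent_bundle) (F : tangent_bundle -> R) :
    Prop := conic_pseudo_finsler A F /\ fundamental_posdef A F.

(* The value h_v(w,w) of the angular metric on the diagonal. *)
Definition angular_metric (F : tangent_bundle -> R) (p : M) (v w : 'rV[R]_d) :
    R :=
  fundamental_tensor F p v w w
  - (F (TVec p v) ^+ 2)^-1 * fundamental_tensor F p v v w ^+ 2.

Definition conic_set (N : nat) (B : set 'rV[R]_N) : Prop :=
  forall x (l : R), B x -> 0 < l -> B (l *: x).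

(* Smoothness of [L] on (B x M) minus ({0} x M). *)
Definition smooth_off_zero (N : nat) (B : set 'rV[R]_N) (L : 'rV[R]_N * M -> R) :
    Prop :=
  forall i : chart_idx M,
    smooth_on [set z : 'rV[R]_N * 'rV[R]_d |
                 [/\ B z.1, z.1 <> 0 & chart_img i z.2]]
      (fun z => L (z.1, coord_inv i z.2) : R^o).

Definition partial1 (N : nat) (L : 'rV[R]_N * M -> R) (r : 'I_N)
    (q : 'rV[R]_N * M) : R :=
  'D_(delta_mx 0 r) (fun x => L (x, q.2) : R^o) q.1.

Definition partial2 (N : nat) (L : 'rV[R]_N * M -> R) (r s : 'I_N)
    (q : 'rV[R]_N * M) : R := partial1 (partial1 L r) s q.

Definition hess (N : nat) (L : 'rV[R]_N * M -> R) (q : 'rV[R]_N * M) :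
    'M[R]_N := \matrix_(r, s) partial2 L r s q.

(* The point of R^(n+m) x M at which L and its derivatives are evaluated. *)
Definition star_point (n m : nat) (F : 'I_n -> tangent_bundle -> R)
    (beta : 'I_m -> tangent_bundle -> R) (v : tangent_bundle) :
    'rV[R]_(n + m) * M :=
  (row_mx (\row_k F k v) (\row_j beta j v), tproj v).

Definition P_vector (n m : nat) (F : 'I_n -> tangent_bundle -> R)
    (beta : 'I_m -> tangent_bundle -> R) (p : M) (v w : 'rV[R]_d) :
    'rV[R]_(n + m) :=
  row_mx (\row_k (fundamental_tensor (F k) p v v w / F k (TVec p v)))
         (\row_j beta j (TVec p w)).

End Tangent.

Definition quad_form (R : realType) (N : nat) (H : 'M[R]_N) (x : 'rV[R]_N) : R :=
  (x *m H *m x^T) 0 0.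

Definition possemidef_mx (R : realType) (N : nat) (H : 'M[R]_N) : Prop :=
  forall x : 'rV[R]_N, 0 <= quad_form H x.

(* Main.v *)
Require Import Defs.
From HB Require Import structures.
From mathcomp Require Import all_boot all_order all_algebra.
From mathcomp Require Import all_classical all_reals all_analysis.
Set Implicit Arguments.
Unset Strict Implicit.
Unset Printing Implicit Defensive.
Import Order.TTheory GRing.Theory Num.Theory.
Import numFieldNormedType.Exports.
Local Open Scope classical_set_scope.
Local Open Scope ring_scope.

(* On a fibre T_pM, F^2 is the composite of L(., p) with the map
   x : v |-> (F_k(v), beta_j(v)), so the chain rule gives
     D_w D_w F^2 = sum_r L_r D_w D_w x_r + sum_rs L_rs D_w x_r D_w x_s.
   The beta_j are linear, and Euler's identities for the 1-homogeneous F_k give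
   D_w F_k = g^k_v(v,w) / F_k(v) and D_w D_w F_k = h^k_v(w,w) / F_k(v), which is
   the formula for g.  Positivity rests on h^k_v being nonnegative, with kernel
   spanned by v; in the direction of v itself, g_v(v,v) = F(v)^2 > 0.
   Smoothness of F is also obtained from the chain rule, in charts. *)

(** Off the open set, the functions in [Ck_on] have arbitrary values. A formula for a derivative
    thus holds only on that set and must be known near a point before it is differentiated again;
    hence the many equalities stated with [\near]. Maps into products or row spaces are written c +
    sum_i g_i e_i with scalar g_i, so that one chain rule serves charts of TM, their slices and the
    arguments of [L]. The identification of T_pM with R^d uses [chart_at p], which may jump with p.
    Regularity on TM is therefore read in charts, and T_pM is recovered as a slice of the chart
    [chart_at p]. Zero vectors are treated apart: A may contain some, and there the metrics and [L]
    are only assumed continuous. The arguments of [L] vanish at them, and homogeneity forces the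
    value 0. *)

(** * Calculus of C^k functions on open sets *)

Section CkCalculus.
Variable R : realType.
Implicit Types V W : normedModType R.

(** The difference [g - f] vanishes near x, so it is its own little-o remainder with differential 0;
    then [g] is [(g - f) + f]. *)
Lemma near_eq_differentiable V W (f g : V -> W) (x : V) :
  (\near x, f x = g x) -> differentiable f x -> differentiable g x.
Proof.
move=> fg df.
have h0 : \near x, (g - f) x = 0.
  by apply: filterS fg => y fgy; rewrite !fctE fgy subrr.
suff dh : differentiable (g - f) x.
  have -> : g = (g - f) + f by rewrite subrK.
  exact: differentiableD.
have hx : (g - f) x = 0 by exact: nbhs_singleton h0.
have E : (g - f) \o shift x = cst ((g - f) x) + \0 +o_ 0 id.
  apply/eqaddoE/eqaddoP => _/posnumP[e].
  move: h0; rewrite (near_shift 0) subr0; apply: filterS => y /= h0.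
  by rewrite -[X in `|X|]/((g - f) (y + x) - ((g - f) x + 0)) h0 hx addr0 subr0
     normr0 mulr_ge0.
have d0 : 'd (g - f) x = \0 :> (V -> W).
  by apply/diff_unique => //; exact: cst_continuous.
apply/diff_locallyP; rewrite d0; split => //; exact: cst_continuous.
Qed.

(** Inside an induction on k, this replaces a derivative by a formula valid on U alone: as U is
    open, equality on U is equality near each of its points and passes to derivatives. *)
Lemma Ck_on_eq V W k (U : set V) (f g : V -> W) :
  open U -> (forall x, U x -> f x = g x) -> Ck_on k U f -> Ck_on k U g.
Proof.
move=> oU; elim: k f g => [|k IH] f g fg /=.
  move=> cf x Ux; have fgx : \near x, f x = g x.
    by apply: filterS (open_nbhs_nbhs (conj oU Ux)); exact: fg.
  rewrite /prop_for /continuous_at -(fg _ Ux).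
  apply: cvg_trans (cf _ Ux); apply: near_eq_cvg.
  exact: fgx.
move=> [df cf]; split=> [x Ux|v].
  apply: near_eq_differentiable (df x Ux).
  by apply: filterS (open_nbhs_nbhs (conj oU Ux)); exact: fg.
apply: IH (cf v) => x Ux; apply: near_eq_derive.
by apply: filterS (open_nbhs_nbhs (conj oU Ux)); exact: fg.
Qed.

Lemma Ck_onS V W k (U : set V) (f : V -> W) : Ck_on k.+1 U f -> Ck_on k U f.
Proof.
elim: k f => [|k IH] f [df cf].
  by move=> x /df; exact: differentiable_continuous.
by split=> [//|v]; exact: IH (cf v).
Qed.

Lemma Ck_on_sub V W k (U U' : set V) (f : V -> W) :
  U `<=` U' -> Ck_on k U' f -> Ck_on k U f.
Proof.
move=> sU; elim: k f => [|k IH] f; first by move=> cf x /sU /cf.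
by move=> [df cf]; split=> [x /sU /df//|v]; exact: IH (cf v).
Qed.

Lemma Ck_on_cst V W k (U : set V) (a : W) : Ck_on k U (cst a).
Proof.
elim: k a => [|k IH] a; first by move=> x _; exact: cst_continuous.
split=> [x _|v]; first exact: differentiable_cst.
by rewrite [X in Ck_on _ _ X](_ : _ = cst 0) ?funeqE// => x; rewrite derive_cst.
Qed.

Lemma differentiable_linear V W (f : V -> W) x :
  linear f -> continuous f -> differentiable f x.
Proof.
move=> lf cf.
pose fL : {linear V -> W} := HB.pack f (GRing.isLinear.Build _ _ _ _ f lf).
exact: (@linear_differentiable _ _ _ fL).
Qed.

Lemma derive_linear V W (f : V -> W) v :
  linear f -> continuous f -> 'D_v f = cst (f v).
Proof.
move=> lf cf.
pose fL : {linear V -> W} := HB.pack f (GRing.isLinear.Build _ _ _ _ f lf).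
rewrite funeqE => x; rewrite deriveE; last exact: differentiable_linear.
by rewrite (@diff_lin _ _ _ fL).
Qed.

Lemma Ck_on_linear V W k (U : set V) (f : V -> W) :
  linear f -> continuous f -> Ck_on k U f.
Proof.
move=> lf cf; case: k => [|k]; first by move=> x _; exact: cf.
split=> [x _|v]; first exact: differentiable_linear.
by rewrite derive_linear//; exact: Ck_on_cst.
Qed.

Lemma Ck_onD V W k (U : set V) (f g : V -> W) : open U ->
  Ck_on k U f -> Ck_on k U g -> Ck_on k U (f + g).
Proof.
move=> oU; elim: k f g => [|k IH] f g.
  by move=> cf cg x Ux; apply: continuousD; [exact: cf|exact: cg].
move=> [df cf] [dg cg]; split=> [x Ux|v].
  by apply: differentiableD; [exact: df|exact: dg].
apply: (Ck_on_eq (f := 'D_v f + 'D_v g)) => //; last exact: IH (cf v) (cg v).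
by move=> x Ux; rewrite deriveD//; apply: diff_derivable; [exact: df|exact: dg].
Qed.

Lemma Ck_onM V k (U : set V) (f g : V -> R^o) : open U ->
  Ck_on k U f -> Ck_on k U g -> Ck_on k U (fun x => f x * g x : R^o).
Proof.
move=> oU; elim: k f g => [|k IH] f g.
  by move=> cf cg x Ux; apply: cvgM; [exact: cf|exact: cg].
move=> /[dup] cfS [df cf] /[dup] cgS [dg cg]; split=> [x Ux|v].
  by apply: differentiableM; [exact: df|exact: dg].
apply: (Ck_on_eq
  (f := (fun x => f x * 'D_v g x : R^o)
        + (fun x => g x * 'D_v f x : R^o))) => //.
  move=> x Ux.
  by rewrite deriveM//; apply: diff_derivable; [exact: df|exact: dg].
apply: Ck_onD => //; apply: IH; [exact: Ck_onS cfS|exact: cg v|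
  exact: Ck_onS cgS|exact: cf v].
Qed.

Lemma Ck_on_sum V W k (U : set V) (I : Type) (r : seq I) (f : I -> V -> W) :
  open U -> (forall i, Ck_on k U (f i)) ->
  Ck_on k U (fun x => \sum_(i <- r) f i x).
Proof.
move=> oU cf; elim: r => [|i r IH].
  by rewrite [X in Ck_on _ _ X](_ : _ = cst 0) ?funeqE;
    [exact: Ck_on_cst|move=> x; rewrite big_nil].
rewrite [X in Ck_on _ _ X](_ : _ = f i + (fun x => \sum_(i <- r) f i x)).
  by apply: Ck_onD.
by rewrite funeqE => x; rewrite big_cons.
Qed.
End CkCalculus.

(** * Chain rule for maps given by scalar coordinates *)

Section Composition.
Variables (R : realType) (V W : normedModType R) (I : finType).
Variables (c : W) (e : I -> W).

Lemma is_diff_lincomb (g : I -> V -> R^o) (r : seq I) (x : V) :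
  (forall i, differentiable (g i) x) ->
  is_diff x (fun y => c + \sum_(i <- r) g i y *: e i)
    (fun v => \sum_(i <- r) 'd (g i) x v *: e i).
Proof.
move=> dg; elim: r => [|i r IH].
  rewrite [X in is_diff_def _ X _](_ : _ = cst c); last first.
    by rewrite funeqE => y; rewrite big_nil addr0.
  rewrite [X in is_diff_def _ _ X](_ : _ = 0); first exact: is_diff_cst.
  by rewrite funeqE => y; rewrite big_nil.
rewrite [X in is_diff_def _ X _](_ : _ = (fun y => g i y *: e i)
  + (fun y => c + \sum_(i <- r) g i y *: e i)); last first.
  by rewrite funeqE => y; rewrite big_cons addrCA.
rewrite [X in is_diff_def _ _ X](_ : _ = (fun v => 'd (g i) x v *: e i)
  + (fun v => \sum_(i <- r) 'd (g i) x v *: e i)); last first.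
  by rewrite funeqE => y; rewrite big_cons.
by apply: is_diffD; apply: DiffDef; [exact: differentiableZl|rewrite diffZl].
Qed.

Variables (g : I -> V -> R^o) (f : W -> R^o).
Let G x := c + \sum_i g i x *: e i.

Lemma differentiable_comp_lincomb (x : V) : (forall i, differentiable (g i) x) ->
  differentiable f (G x) -> differentiable (f \o G) x.
Proof.
move=> /(is_diff_lincomb (index_enum I))[dG _] df.
exact: differentiable_comp.
Qed.

Lemma derive_comp_lincomb (x v : V) : (forall i, differentiable (g i) x) ->
  differentiable f (G x) ->
  'D_v (f \o G) x = \sum_i 'D_v (g i) x * 'D_(e i) f (G x).
Proof.
move=> dg df; have [dG eG] := is_diff_lincomb (index_enum I) dg.
rewrite deriveE; last exact: differentiable_comp.
rewrite diff_comp//= eG linear_sum; apply: eq_bigr => i _.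
by rewrite linearZ/= !deriveE.
Qed.
End Composition.

(* The inner map is given by its coordinates g_i along vectors e_i, which need
   not form a basis: only scalar functions have to be differentiated. *)
Lemma Ck_on_comp (R : realType) (V W : normedModType R) k (U : set V)
    (U' : set W) (I : finType) (c : W) (e : I -> W) (g : I -> V -> R^o)
    (f : W -> R^o) : open U ->
  (forall x, U x -> U' (c + \sum_i g i x *: e i)) ->
  (forall i, Ck_on k U (g i)) -> Ck_on k U' f ->
  Ck_on k U (fun x => f (c + \sum_i g i x *: e i)).
Proof.
move=> oU UU'; elim: k f => [|k IH] f cg cf.
  move=> x Ux; apply: (@continuous_comp _ _ _ (fun x => c + \sum_i g i x *: e i)).
    apply: continuousD; first exact: cst_continuous.
    apply: (@cvg_big _ _ +%R 0 predT); first exact: add_continuous.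
    by move=> i _; apply: cvgZr_tmp; exact: cg.
  by apply: cf; exact: UU'.
have dg x i : U x -> differentiable (g i) x by case: (cg i) => + _; apply.
have df x : U' x -> differentiable f x by case: cf => + _; apply.
split=> [x Ux|v].
  by apply: (differentiable_comp_lincomb (fun i => dg x i Ux)); exact/df/UU'.
apply: (Ck_on_eq (f := fun x => \sum_i
  ('D_v (g i) x * 'D_(e i) f (c + \sum_i g i x *: e i) : R^o))) => //.
  move=> x Ux; rewrite (derive_comp_lincomb _ (fun i => dg x i Ux))//.
  exact/df/UU'.
apply: Ck_on_sum => // i; apply: Ck_onM => //.
  by case: (cg i) => _; apply.
have [_ cDf] := cf.
exact: (IH _ (fun j => Ck_onS (cg j)) (cDf (e i))).
Qed.

(** All exponents are treated at once because differentiation lowers the exponent by 1. The square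
    root is the case a = 1/2. *)
Lemma Ck_on_powR (R : realType) k (a : R) :
  Ck_on k [set x : R^o | 0 < x] (fun x : R^o => x `^ a : R^o).
Proof.
have oP : open [set x : R^o | 0 < x] by exact: (@open_gt R 0).
have dP (b x : R) : 0 < x -> differentiable (fun x : R^o => x `^ b : R^o) x.
  move=> x0; apply/derivable1_diffP.
  by have [] := is_derive1_powR b x0.
elim: k a => [|k IH] a.
  move=> x x0; apply: differentiable_continuous; exact: dP.
split=> [y|v]; first exact: dP.
apply: (Ck_on_eq (f := fun x : R^o =>
  cst (v * a : R^o) x * x `^ (a - 1) : R^o)) => //.
  move=> y y0 /=; rewrite deriveE; last exact: dP.
  rewrite diff1E; last exact: dP.
  by have [_] := is_derive1_powR a y0; rewrite derive1E => ->; rewrite /= -mulrA.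
by apply: Ck_onM => //; exact: Ck_on_cst.
Qed.

Lemma Ck_on_sqrt (R : realType) (V : normedModType R) k (U : set V)
    (f : V -> R^o) : open U -> (forall x, U x -> 0 < f x) -> Ck_on k U f ->
  Ck_on k U (fun x => Num.sqrt (f x) : R^o).
Proof.
move=> oU f0 cf.
(* A scalar function is a one-term combination along the vector 1, the shape that [Ck_on_comp]
   accepts. *)
have E x : 0 + \sum_(i < 1) f x *: (1 : R^o) = f x.
  by rewrite big_ord1 add0r; exact: mulr1.
apply: (Ck_on_eq (f := fun x =>
  ((0 + \sum_(i < 1) f x *: (1 : R^o)) : R^o) `^ 2^-1 : R^o)) => //.
  by move=> x Ux; rewrite E powR12_sqrt// ltW// f0.
apply: (@Ck_on_comp R _ _ k U [set x : R^o | 0 < x] _ 0 (fun=> 1)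
  (fun=> f) (fun x : R^o => x `^ 2^-1 : R^o)) => //.
  by move=> x Ux; rewrite E; exact: f0.
exact: Ck_on_powR.
Qed.

(** * Directional derivatives *)

Section Directional.
Variables (R : realType) (V : normedModType R).
Implicit Types (f : V -> R^o) (u v w x : V).

Lemma derive_line f v x : 'D_v f x = 'D_1 (fun h : R => f (h *: v + x)) 0.
Proof.
rewrite /derive; set g1 := fun h => h^-1 *: _; set g2 := fun h => h^-1 *: _.
suff -> : g1 = g2 by [].
rewrite funeqE /g1 /g2 => h /=.
by rewrite addr0 scale0r add0r [_%:A]mulr1.
Qed.

Lemma derive1_line f v x :
  derive1 (fun h : R => f (x + h *: v) : R^o) 0 = 'D_v f x.
Proof.
rewrite derive1E (derive_line f v x).
suff -> : (fun h : R => f (x + h *: v)) = (fun h : R => f (h *: v + x)) by [].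
by rewrite funeqE => h; rewrite addrC.
Qed.

Lemma deriveDdir f v w x (c : R) : differentiable f x ->
  'D_(w + c *: v) f x = 'D_w f x + c * 'D_v f x.
Proof. by move=> df; rewrite !deriveE// linearD linearZ. Qed.

Lemma near_line (U : set V) v x : open U -> U x ->
  \forall h \near (0 : R), U (h *: v + x).
Proof.
move=> oU Ux.
have : (h *: v + x) @[h --> (0 : R)] --> x.
  rewrite -[X in _ --> X]add0r -[X in _ --> X + _](scale0r v).
  by apply: cvgD; [apply: cvgZr_tmp; exact: cvg_id|exact: cvg_cst].
by apply; exact: open_nbhs_nbhs.
Qed.

(** For f = F on a tangent space the left side is the fundamental tensor. One product rule gives D_w
    f^2 = 2 f D_w f on all of U, and a second one differentiates this. *)
Lemma derive2_sqr (U : set V) f u w x : open U -> U x ->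
  (forall y, U y -> differentiable f y) -> differentiable ('D_w f) x ->
  2^-1 * 'D_u ('D_w (fun y => f y ^+ 2 : R^o)) x =
    'D_u f x * 'D_w f x + f x * 'D_u ('D_w f) x.
Proof.
move=> oU Ux df dDf.
have E : \near x, 'D_w (fun y => f y ^+ 2 : R^o) x = (2 *: (f * 'D_w f)) x.
  apply: filterS (open_nbhs_nbhs (conj oU Ux)) => y /df dfy.
  rewrite -[LHS]/('D_w ((f : V -> R) * (f : V -> R)) y).
  rewrite deriveM; try exact: diff_derivable.
  by rewrite -mulr2n -scaler_nat.
have dfx : derivable f x u by apply: diff_derivable; exact: df.
have dDfx : derivable ('D_w f) x u by exact: diff_derivable.
have D : 'D_u (2 *: (f * 'D_w f)) x =
    2 * (f x * 'D_u ('D_w f) x + 'D_w f x * 'D_u f x).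
  by rewrite (deriveZ 2 (derivableM dfx dDfx)) (deriveM dfx dDfx).
rewrite (near_eq_derive _ E) D mulrA mulVf ?pnatr_eq0// mul1r.
by rewrite addrC [X in X + _]mulrC.
Qed.
End Directional.

(** * Euler's identities for 1-homogeneous functions *)

Section Homogeneous.
Variables (R : realType) (V : normedModType R) (U : set V) (f : V -> R^o).
Hypotheses (oU : open U) (f_C2 : Ck_on 2 U f).
Hypothesis U_conic : forall (l : R) x, 0 < l -> U x -> U (l *: x).
Hypothesis f_homo : forall (l : R) x, 0 < l -> U x -> f (l *: x) = l * f x.

Let df x : U x -> differentiable f x.
Proof. by case: f_C2 => + _; apply. Qed.

Let dDf w x : U x -> differentiable ('D_w f) x.
Proof. by case: f_C2 => _ /(_ w)[+ _]; apply. Qed.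

Lemma euler_derive v : U v -> 'D_v f v = f v.
Proof.
move=> Uv; rewrite derive_line.
(* Homogeneity needs a positive factor, here [h + 1], hence h near 0. *)
have E : \forall h \near (0 : R), f (h *: v + v) = (f v \o* (id + cst 1)) h.
  near=> h; have h0 : 0 < h + 1.
    by rewrite -ltrBlDr sub0r; near: h; apply: lt_nbhsr; rewrite oppr_lt0.
  by rewrite -[X in _ + X]scale1r -scalerDl f_homo.
rewrite (near_eq_derive _ E) deriveMr; last exact: derivableD.
by rewrite deriveD// derive_id derive_cst addr0 mulr1.
Unshelve. all: by end_near. Qed.

(** Differentiating [f (l x) = l f x] in x brings out a factor [l] on both sides, and it cancels. *)
Lemma derive_homo0 v w (l : R) : 0 < l -> U v -> 'D_w f (l *: v) = 'D_w f v.
Proof.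
move=> l0 Uv; have dfl := df (U_conic l0 Uv).
have E : \near v, (f \o *:%R l) v = (l *: f) v.
  by apply: filterS (open_nbhs_nbhs (conj oU Uv)) => y Uy /=; exact: f_homo.
have : 'D_w (f \o *:%R l) v = l * 'D_w f v.
  by rewrite (near_eq_derive _ E) deriveZ//; apply: diff_derivable; exact: df.
have dl := is_diff_scaler l v.
rewrite deriveE; last exact: differentiable_comp.
rewrite diff_comp//= diff_val linearZ/= -deriveE//.
by move/mulfI; apply; rewrite gt_eqF.
Qed.

Lemma derive_radial_derive v w : U v -> 'D_v ('D_w f) v = 0.
Proof.
move=> Uv; rewrite derive_line.
have E : \forall h \near (0 : R), 'D_w f (h *: v + v) = cst ('D_w f v) h.
  near=> h; have h0 : 0 < h + 1.
    by rewrite -ltrBlDr sub0r; near: h; apply: lt_nbhsr; rewrite oppr_lt0.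
  by rewrite -[X in _ + X]scale1r -scalerDl derive_homo0.
by rewrite (near_eq_derive _ E) derive_cst.
Unshelve. all: by end_near. Qed.

(* Symmetry of second derivatives is not available; instead, near v one differentiates
   D_v f(u) = D_u f(u) - h D_w f(u) = f(u) - h D_w f(u), where u = v + h w. *)
Lemma derive_derive_radial v w : U v -> 'D_w ('D_v f) v = 0.
Proof.
move=> Uv; rewrite derive_line.
pose l (h : R) := h *: w + v.
have dl : differentiable l 0 by [].
have l0 : l 0 = v by rewrite /l scale0r add0r.
have E : \forall h \near (0 : R), 'D_v f (l h) = (f \o l - id * ('D_w f \o l)) h.
  near=> h; have Ul : U (l h) by near: h; exact: near_line.
  rewrite !fctE /= -(euler_derive Ul) -mulNr -deriveDdir; last exact: df.
  by rewrite scaleNr /l addrAC subrr add0r.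
rewrite (near_eq_derive _ E).
have df1 : derivable (f \o l) 0 1.
  apply: diff_derivable; apply: differentiable_comp => //.
  by rewrite l0; exact: df.
have df2 : derivable ('D_w f \o l) 0 1.
  apply: diff_derivable; apply: differentiable_comp => //.
  by rewrite l0; exact: dDf.
have did : derivable (id : R -> R) 0 1 by exact: derivable_id.
have D : 'D_1 (id * ('D_w f \o l)) (0 : R) = 'D_w f (l 0).
  by rewrite (deriveM did df2) derive_id scale0r add0r; exact: mulr1.
by rewrite (deriveB df1 (derivableM did df2)) D -derive_line l0 subrr.
Unshelve. all: by end_near. Qed.

(** The direction v is in the kernel of the second derivative of f at v, in either argument, so
    every term containing c drops out. *)
Lemma derive2_shift_radial v w (c : R) : U v ->
  'D_(w + c *: v) ('D_(w + c *: v) f) v = 'D_w ('D_w f) v.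
Proof.
move=> Uv.
have E : \forall y \near v, 'D_(w + c *: v) f y = ('D_w f + c *: 'D_v f) y.
  apply: filterS (open_nbhs_nbhs (conj oU Uv)) => y Uy.
  by rewrite deriveDdir//; exact: df.
rewrite (near_eq_derive _ E).
have dw u u' : derivable ('D_u f) v u' by apply: diff_derivable; exact: dDf.
rewrite (deriveD (dw _ _) (@derivableZ _ _ _ _ c _ _ (dw _ _))).
rewrite (deriveZ c (dw _ _)).
rewrite (deriveDdir _ _ _ (dDf w Uv)) (deriveDdir _ _ _ (dDf v Uv)).
rewrite !(derive_radial_derive _ Uv) (derive_derive_radial _ Uv).
by rewrite !mulr0 !addr0 scaler0 addr0.
Qed.
End Homogeneous.

(** The derivative along [e r] is taken before the one along [e s], as in [partial2 L r s], so that
    no symmetry of second derivatives is invoked. *)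
Lemma derive2_comp_lincomb (R : realType) (V W : normedModType R) (N : nat)
    (c : W) (e : 'I_N -> W) (g : 'I_N -> V -> R^o) (f : W -> R^o)
    (U : set V) (U' : set W) (x w : V) :
  let G y := c + \sum_i g i y *: e i in
  open U -> U x -> (forall y, U y -> U' (G y)) ->
  (forall i, Ck_on 2 U (g i)) -> Ck_on 2 U' f ->
  'D_w ('D_w (f \o G)) x =
    \sum_r 'D_w ('D_w (g r)) x * 'D_(e r) f (G x)
    + \sum_r \sum_s 'D_w (g r) x * 'D_w (g s) x * 'D_(e s) ('D_(e r) f) (G x).
Proof.
move=> G oU Ux UU' cg cf.
have dg i y : U y -> differentiable (g i) y by case: (cg i) => + _; apply.
have dDg i y : U y -> differentiable ('D_w (g i)) y.
  by case: (cg i) => _ /(_ w)[+ _]; apply.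
have df y : U y -> differentiable f (G y) by move/UU'; case: cf => + _; apply.
have dDf i y : U y -> differentiable ('D_(e i) f) (G y).
  by move/UU'; case: cf => _ /(_ (e i))[+ _]; apply.
have E : \forall y \near x, 'D_w (f \o G) y =
    (\sum_r ('D_w (g r) * ('D_(e r) f \o G))) y.
  apply: filterS (open_nbhs_nbhs (conj oU Ux)) => y Uy.
  by rewrite (derive_comp_lincomb _ (fun i => dg i y Uy) (df y Uy)) fct_sumE.
have d1 r : derivable ('D_w (g r)) x w by apply: diff_derivable; exact: dDg.
have d2 r : derivable ('D_(e r) f \o G) x w.
  apply: diff_derivable.
  exact: (differentiable_comp_lincomb (fun i => dg i x Ux) (dDf r x Ux)).
rewrite (near_eq_derive _ E) (derive_sum (fun r => derivableM (d1 r) (d2 r))).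
rewrite -big_split; apply: eq_bigr => r _ /=.
have D : 'D_w ('D_(e r) f \o G) x =
    \sum_s 'D_w (g s) x * 'D_(e s) ('D_(e r) f) (G x).
  exact: (derive_comp_lincomb _ (fun i => dg i x Ux) (dDf r x Ux)).
rewrite (deriveM (d1 r) (d2 r)) D [RHS]addrC.
congr (_ + _); last exact: mulrC.
rewrite /GRing.scale /= mulr_sumr.
by apply: eq_bigr => s _; rewrite mulrA.
Qed.

(** * Coordinates of row vectors and of pairs of them *)

Section RowVectors.
Variable R : realType.

Lemma Ck_on_coord N k (U : set 'rV[R]_N) (j : 'I_N) :
  Ck_on k U (fun x => x 0 j : R^o).
Proof.
apply: Ck_on_linear; first by move=> a x y; rewrite !mxE.
exact: coord_continuous.
Qed.

Lemma linear_rowE N (f : 'rV[R]_N -> R^o) (x : 'rV[R]_N) : linear f ->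
  f x = \sum_j x 0 j * f (delta_mx 0 j).
Proof.
move=> lf; rewrite [in LHS](row_sum_delta x).
pose fL : {linear 'rV[R]_N -> R^o} :=
  HB.pack f (GRing.isLinear.Build _ _ _ _ f lf).
rewrite -[f]/(fL : _ -> _) linear_sum; apply: eq_bigr => j _.
by rewrite linearZ.
Qed.

Lemma linear_row_continuous N (f : 'rV[R]_N -> R^o) : linear f -> continuous f.
Proof.
move=> lf x; suff : Ck_on 0 setT f by apply.
rewrite [X in Ck_on _ _ X](_ : _ = fun y : 'rV[R]_N =>
    \sum_j (y 0 j * cst (f (delta_mx 0 j) : R^o) y : R^o)); last first.
  by rewrite funeqE => y; exact: linear_rowE.
apply: Ck_on_sum => [|j]; first exact: openT.
by apply: Ck_onM; [exact: openT|exact: Ck_on_coord|exact: Ck_on_cst].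
Qed.

Variables (N d : nat).

Lemma Ck_on_coord_fst k (U : set ('rV[R]_N * 'rV[R]_d)) (j : 'I_N) :
  Ck_on k U (fun z => z.1 0 j : R^o).
Proof.
apply: Ck_on_linear => [a z t|z]; first by rewrite !mxE.
have fst_cont : {for z, continuous (@fst 'rV[R]_N 'rV[R]_d)}.
  by case: z => x y; exact: cvg_fst.
exact: continuous_comp fst_cont (@coord_continuous _ _ _ 0 j z.1).
Qed.

Lemma Ck_on_coord_snd k (U : set ('rV[R]_N * 'rV[R]_d)) (j : 'I_d) :
  Ck_on k U (fun z => z.2 0 j : R^o).
Proof.
apply: Ck_on_linear => [a z t|z]; first by rewrite !mxE.
have snd_cont : {for z, continuous (@snd 'rV[R]_N 'rV[R]_d)}.
  by case: z => x y; exact: cvg_snd.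
exact: continuous_comp snd_cont (@coord_continuous _ _ _ 0 j z.2).
Qed.

(** Indexing by a disjoint sum puts a map into a product in the form c + sum_i g_i e_i required by
    [Ck_on_comp]. *)
Definition pair_coord (x : 'rV[R]_N) (y : 'rV[R]_d) (s : 'I_N + 'I_d) : R :=
  match s with inl r => x 0 r | inr j => y 0 j end.

Definition pair_delta (s : 'I_N + 'I_d) : 'rV[R]_N * 'rV[R]_d :=
  match s with inl r => (delta_mx 0 r, 0) | inr j => (0, delta_mx 0 j) end.

Lemma pair_lincomb (x : 'rV[R]_N) (y : 'rV[R]_d) :
  (x, y) = 0 + \sum_s pair_coord x y s *: pair_delta s.
Proof.
rewrite add0r big_sumType /=.
have -> : \sum_r x 0 r *: (delta_mx 0 r : 'rV[R]_N, 0 : 'rV[R]_d) = (x, 0).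
  rewrite [in RHS](row_sum_delta x).
  elim/big_rec2 : _ => // j y1 y2 _ ->.
  by rewrite -[LHS]/(_, _) /= scaler0 addr0.
have -> : \sum_j y 0 j *: (0 : 'rV[R]_N, delta_mx 0 j : 'rV[R]_d) = (0, y).
  rewrite [in RHS](row_sum_delta y).
  elim/big_rec2 : _ => // j y1 y2 _ ->.
  by rewrite -[LHS]/(_, _) /= scaler0 addr0.
by rewrite -[RHS]/(_, _) /= addr0 add0r.
Qed.
End RowVectors.

(** * Charts of the manifold and of its tangent bundle *)

Section Charts.
Variables (R : realType) (d : nat) (M : manifold R d).


Lemma coord_inv_dom (i : chart_idx M) y :
  chart_img i y -> chart_dom i (coord_inv i y).
Proof. by move=> [q dq <-]; rewrite Defs.coordK ?in_setE. Qed.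

Lemma coord_invK (i : chart_idx M) y :
  chart_img i y -> Defs.coord i (coord_inv i y) = y.
Proof. by move=> [q dq <-]; rewrite Defs.coordK ?in_setE. Qed.

Lemma chart_img_at (p : M) : chart_img (chart_at p) (Defs.coord (chart_at p) p).
Proof. by exists p => //; exact: chart_at_dom. Qed.

Lemma coord_inv_at (p : M) :
  coord_inv (chart_at p) (Defs.coord (chart_at p) p) = p.
Proof. by rewrite Defs.coordK// in_setE; exact: chart_at_dom. Qed.

Lemma continuous_coord_inv (i : chart_idx M) y : chart_img i y ->
  {for y, continuous (coord_inv i)}.
Proof.
move=> iy; have := @coord_inv_continuous _ _ M i.
rewrite continuous_open_subspace; last exact: chart_img_open.
by move=> /(_ y); apply; rewrite in_setE.
Qed.

(** From the chart [chart_at p] to itself the transition map is the identity near the image of p, so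
    components are unchanged. *)
Lemma tchart_inv_at (p : M) u :
  tchart_inv (chart_at p) (Defs.coord (chart_at p) p, u) = TVec p u.
Proof.
rewrite /tchart_inv /= coord_inv_at; congr TVec.
have E : \forall y \near Defs.coord (chart_at p) p,
    (Defs.coord (chart_at p) \o coord_inv (chart_at p)) y = id y.
  apply: filterS (open_nbhs_nbhs (conj _ (chart_img_at p))).
    by move=> y /coord_invK.
  exact: chart_img_open.
by rewrite (near_eq_derive _ E) derive_id.
Qed.

(** These components are the differential at y of a transition map, applied to u. *)
Lemma tchart_inv_linear (i : chart_idx M) y : chart_img i y ->
  linear (fun u => tvec (tchart_inv i (y, u))).
Proof.
move=> iy a u v; rewrite /tchart_inv /=.
set j := chart_at _.
have df : differentiable (Defs.coord j \o coord_inv i) y.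
  have [+ _] := @transition_smooth _ _ M i j 1%N; apply.
  exists (coord_inv i y); last exact: coord_invK.
  by split; [exact: coord_inv_dom|exact: chart_at_dom].
by rewrite !deriveE// linearP.
Qed.
End Charts.

(** * A conic metric restricted to one tangent space *)

Section Fibers.
Variables (R : realType) (d : nat) (M : manifold R d).
Variables (A : set (tangent_bundle M)) (F : tangent_bundle M -> R).

(** As [tvec] may jump with the base point, openness of [tvec v <> 0] is read off F: on A it means
    that F v is nonzero, and F is continuous in charts. *)
Lemma tangent_open_nonzero : conic_pseudo_finsler A F ->
  tangent_open (nonzero_part A).
Proof.
move=> cF i.
have -> : tcoords i (nonzero_part A) =
    tcoords i A `&` (F \o tchart_inv i) @^-1` [set x | x != 0].
  apply/seteqP; split=> z.
    move=> [iz [Az z0]]; split; first by split.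
    by apply/eqP => /(cpf_eq0 cF Az).
  move=> [[iz Az] /= Fz]; split=> //; split=> //.
  by move=> /(cpf_eq0 cF Az) Fz0; rewrite Fz0 eqxx in Fz.
rewrite openE => z [Az Fz]; apply: filterI.
  by apply: open_nbhs_nbhs; split=> //; exact: (cpf_open cF).
apply: (cpf_continuous cF Az).
by apply: open_nbhs_nbhs; split=> //; exact: open_neq.
Qed.

Definition fiber (p : M) : set 'rV[R]_d := [set u | nonzero_part A (TVec p u)].

Lemma fiber_conic p (l : R) u : conic_pseudo_finsler A F ->
  0 < l -> fiber p u -> fiber p (l *: u).
Proof.
move=> cF l0 [/= Au u0]; split; first exact: (cpf_conic cF).
by move=> /eqP; rewrite scaler_eq0 gt_eqF//= => /eqP.
Qed.

Lemma fiberE p u : fiber p u =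
  tcoords (chart_at p) (nonzero_part A) (Defs.coord (chart_at p) p, u).
Proof.
rewrite /fiber /tcoords /= tchart_inv_at propeqE.
by split=> [?|[]//]; split=> //; exact: chart_img_at.
Qed.

Lemma fiber_open p : conic_pseudo_finsler A F -> open (fiber p).
Proof.
move=> cF; rewrite openE => u; rewrite fiberE => Uu.
have nU := open_nbhs_nbhs (conj (tangent_open_nonzero cF (i := chart_at p)) Uu).
have cp : {for u, continuous (fun u => (Defs.coord (chart_at p) p, u))}.
  move=> S [[S1 S2] [/= n1 n2] S12].
  by apply: filterS n2 => x S2x; apply: S12; split=> //; exact: nbhs_singleton n1.
suff : nbhs u (fiber p) by [].
have pU : nbhs u (fun x => tcoords (chart_at p) (nonzero_part A)
    (Defs.coord (chart_at p) p, x)) by exact: cp nU.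
by apply: filterS pU => x; rewrite fiberE.
Qed.

(** Freezing the base coordinates at those of p exhibits F on T_pM as its chart expression along a
    slice. *)
Lemma fiber_smooth p : conic_pseudo_finsler A F ->
  smooth_on (fiber p) (fun u => F (TVec p u) : R^o).
Proof.
move=> cF k; set y := Defs.coord (chart_at p) p.
pose G (u : 'rV[R]_d) := 0 + \sum_s pair_coord y u s *: @pair_delta R d d s.
pose f (u : 'rV[R]_d) : R^o := (F \o tchart_inv (chart_at p)) (G u).
have EG u : G u = (y, u) by rewrite /G -pair_lincomb.
refine (@Ck_on_eq R _ _ k _ f _ (fiber_open (p := p) cF) _ _).
  by move=> u _; rewrite /f EG /= tchart_inv_at.
refine (@Ck_on_comp R _ _ k _ (tcoords (chart_at p) (nonzero_part A)) _ 0
  (@pair_delta R d d) (fun s u => pair_coord y u s) (F \o tchart_inv (chart_at p))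
  (fiber_open (p := p) cF) _ _ (cpf_smooth cF (chart_at p) k)).
- by move=> u; rewrite -[X in tcoords _ _ X]/(G u) EG fiberE.
- by move=> [j|j]; [exact: Ck_on_cst|exact: Ck_on_coord].
Qed.

Lemma fundamental_tensorE p v u w : fundamental_tensor F p v u w =
  2^-1 * 'D_u ('D_w (fun x => F (TVec p x) ^+ 2 : R^o)) v.
Proof.
rewrite /fundamental_tensor; set Phi := fun x => F (TVec p x) ^+ 2 : R^o.
rewrite -(derive1_line ('D_w Phi) u v).
suff -> : (fun t : R => derive1 (fun s : R =>
    F (TVec p (v + t *: u + s *: w)) ^+ 2 : R^o) 0 : R^o) =
  (fun h => 'D_w Phi (v + h *: u)) by [].
by rewrite funeqE => t; exact: (derive1_line Phi w).
Qed.

Section AtVector.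
Variables (p : M) (v : 'rV[R]_d).
Hypotheses (cF : conic_pseudo_finsler A F) (Av : A (TVec p v)) (v0 : v <> 0).
Let f (u : 'rV[R]_d) : R^o := F (TVec p u).
Let Uv : fiber p v. Proof. by []. Qed.
Let oU : open (fiber p). Proof. exact: fiber_open. Qed.
Let f2 : Ck_on 2 (fiber p) f. Proof. exact: fiber_smooth. Qed.
Let U_conic (l : R) x : 0 < l -> fiber p x -> fiber p (l *: x).
Proof. exact: fiber_conic. Qed.
Let f_homo (l : R) x : 0 < l -> fiber p x -> f (l *: x) = l * f x.
Proof. by move=> l0 [Ax _]; exact: (cpf_homo cF). Qed.

Let f_gt0 : 0 < f v.
Proof.
rewrite lt_neqAle (cpf_ge0 cF Av) andbT eq_sym.
by apply/eqP => /(cpf_eq0 cF Av).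
Qed.

Let ftE u w : fundamental_tensor F p v u w =
  'D_u f v * 'D_w f v + f v * 'D_u ('D_w f) v.
Proof.
rewrite fundamental_tensorE; apply: (derive2_sqr _ oU Uv).
  by case: f2 => + _; apply.
by case: f2 => _ /(_ w)[+ _]; apply.
Qed.

Lemma fundamental_tensor_radial w :
  fundamental_tensor F p v v w = F (TVec p v) * 'D_w f v.
Proof.
rewrite ftE (derive_radial_derive oU f2 U_conic f_homo _ Uv).
by rewrite (euler_derive f_homo Uv) mulr0 addr0.
Qed.

Lemma angular_metricE w :
  angular_metric F p v w = F (TVec p v) * 'D_w ('D_w f) v.
Proof.
rewrite /angular_metric fundamental_tensor_radial ftE exprMn mulrA mulVf ?mul1r.
  by rewrite addrAC -expr2 subrr add0r.
by rewrite expf_eq0 /= gt_eqF.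
Qed.

(* Evaluating g_v at the component of w that is g_v-orthogonal to v replaces the
   Cauchy-Schwarz inequality, which would need g_v to be symmetric, i.e. the
   symmetry of second derivatives. *)
Lemma fundamental_tensor_shift w :
  let w' := w + (- ('D_w f v / f v)) *: v in
  fundamental_tensor F p v w' w' = angular_metric F p v w.
Proof.
move=> w'; rewrite ftE angular_metricE.
rewrite (derive2_shift_radial oU f2 U_conic f_homo _ _ Uv).
suff -> : 'D_w' f v = 0 by rewrite mul0r add0r.
rewrite deriveDdir; last by case: f2 => + _; apply.
by rewrite (euler_derive f_homo Uv) mulNr divfK ?subrr// gt_eqF.
Qed.

(** Instead of bilinearity of g_v, the proof views [c *: v] as a radial shift of the zero direction,
    along which second derivatives vanish. *)
Lemma fundamental_tensor_parallel (c : R) :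
  fundamental_tensor F p v (c *: v) (c *: v) = c ^+ 2 * F (TVec p v) ^+ 2.
Proof.
rewrite -[c *: v]add0r ftE (derive2_shift_radial oU f2 U_conic f_homo _ _ Uv).
rewrite deriveDdir; last by case: f2 => + _; apply.
rewrite (euler_derive f_homo Uv) derive0 add0r -expr2 exprMn.
have -> : 'D_0 f = cst 0 by rewrite funeqE => x; exact: derive0.
by rewrite derive_cst mulr0 addr0.
Qed.
End AtVector.

Lemma angular_metric_ge0 p v w : conic_finsler A F -> A (TVec p v) -> v <> 0 ->
  0 <= angular_metric F p v w.
Proof.
move=> [cF pF] Av v0; rewrite -(fundamental_tensor_shift cF Av v0).
(* If w is parallel to v then w' = 0, which positive definiteness does not cover; the value is then
   0 by the radial formula with c = 0. *)
set w' := w + _; have [->|/eqP w0] := eqVneq w' 0; last exact/ltW/pF.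
by rewrite -(scale0r v) (fundamental_tensor_parallel cF Av v0) expr0n mul0r.
Qed.

Lemma angular_metric_gt0 p v w : conic_finsler A F -> A (TVec p v) -> v <> 0 ->
  (forall c : R, w <> c *: v) -> 0 < angular_metric F p v w.
Proof.
move=> [cF pF] Av v0 wv; rewrite -(fundamental_tensor_shift cF Av v0).
apply: pF => //; rewrite scaleNr => /subr0_eq; exact: wv.
Qed.
End Fibers.

(** * Smoothness of one-forms on the tangent bundle *)

Section OneForms.
Variables (R : realType) (d : nat) (M : manifold R d).
Variable b : tangent_bundle M -> R.
Hypothesis b_form : one_form b.

Lemma one_form_linear (p : M) : linear (fun u => b (TVec p u) : R^o).
Proof. by move=> a x y; have [+ _] := b_form => ->. Qed.

Lemma one_form_chart (i : chart_idx M) y u : chart_img i y ->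
  b (tchart_inv i (y, u)) =
  \sum_j u 0 j * b (tchart_inv i (y, delta_mx 0 j)).
Proof.
move=> iy; apply: (@linear_rowE R d (fun u => b (tchart_inv i (y, u)))).
move=> a v w; have := tchart_inv_linear iy a v w; rewrite /tchart_inv /= => ->.
exact: one_form_linear.
Qed.

Lemma open_chart_fst (i : chart_idx M) :
  open [set z : 'rV[R]_d * 'rV[R]_d | chart_img i z.1].
Proof.
apply: (@open_comp _ _ fst (chart_img i)); last exact: chart_img_open.
by move=> [x y] _; exact: cvg_fst.
Qed.

(** The definition gives smoothness only along fixed basis vectors; fibrewise linearity extends it
    through the sum of u_j b_j(y). *)
Lemma one_form_smooth (i : chart_idx M) :
  smooth_on [set z | chart_img i z.1] (b \o tchart_inv i : _ -> R^o).
Proof.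
move=> k.
pose G (z : 'rV[R]_d * 'rV[R]_d) : 'rV[R]_d :=
  0 + \sum_l z.1 0 l *: delta_mx 0 l.
have EG z : G z = z.1 by rewrite /G add0r -row_sum_delta.
pose f (z : 'rV[R]_d * 'rV[R]_d) : R^o :=
  \sum_j (z.2 0 j : R^o) * b (tchart_inv i (G z, delta_mx 0 j)).
refine (@Ck_on_eq R _ _ k _ f _ (open_chart_fst (i := i)) _ _).
  move=> [y u] iy; rewrite /f /= one_form_chart//.
  by apply: eq_bigr => j _; rewrite EG.
apply: Ck_on_sum => [|j]; first exact: open_chart_fst.
apply: Ck_onM; first exact: open_chart_fst.
  exact: Ck_on_coord_snd.
refine (@Ck_on_comp R _ _ k _ (chart_img i) _ 0
  (fun l : 'I_d => delta_mx 0 l) (fun l (z : 'rV[R]_d * 'rV[R]_d) => z.1 0 l)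
  (fun y : 'rV[R]_d => b (tchart_inv i (y, delta_mx 0 j)))
  (open_chart_fst (i := i)) _ _
  (b_form.2 i j k)).
- by move=> z iz; rewrite -[X in chart_img i X]/(G z) EG.
- by move=> l; exact: Ck_on_coord_fst.
Qed.
End OneForms.

(** * Regularity and homogeneity of F *)

Section Combination.
Variables (R : realType) (d : nat) (M : manifold R d) (n m : nat).
Variables (Ak : 'I_n -> set (tangent_bundle M)).
Variables (Fk : 'I_n -> tangent_bundle M -> R).
Variables (beta : 'I_m -> tangent_bundle M -> R) (A : set (tangent_bundle M)).
Variables (B : set 'rV[R]_(n + m)) (L : 'rV[R]_(n + m) * M -> R).
Hypothesis n_ge1 : (1 <= n)%N.
Hypothesis Fk_finsler : forall k, conic_finsler (Ak k) (Fk k).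
Hypothesis beta_form : forall j, one_form (beta j).
Hypothesis A_def : A = \bigcap_k Ak k.
Hypothesis A_proj : @tproj R d M @` A = setT.
Hypothesis B_open : open B.
Hypothesis L_cont : {within B `*` setT, continuous L}.
Hypothesis L_smooth : smooth_off_zero B L.
Hypothesis L_pos : forall x p, B x -> x <> 0 -> 0 < L (x, p).
Hypothesis L_homo : forall (l : R) x p, 0 < l -> B x ->
  L (l *: x, p) = l ^+ 2 * L (x, p).
Hypothesis star_in : forall v, A v -> (B `*` setT) (star_point Fk beta v).

Let star v : 'rV[R]_(n + m) := (star_point Fk beta v).1.
Let F v := Num.sqrt (L (star_point Fk beta v)).
Let k0 : 'I_n := Ordinal n_ge1.

Let star_l v k : star v 0 (lshift m k) = Fk k v.
Proof. by rewrite /star /= row_mxEl mxE. Qed.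

Let star_r v j : star v 0 (rshift n j) = beta j v.
Proof. by rewrite /star /= row_mxEr mxE. Qed.

Let A_sub k : A `<=` Ak k.
Proof. by rewrite A_def => v /(_ k I). Qed.

Let nonzero_sub k : nonzero_part A `<=` nonzero_part (Ak k).
Proof. by move=> v [/(@A_sub k _) ? ?]. Qed.

Let cFk k : conic_pseudo_finsler (Ak k) (Fk k).
Proof. by have [] := Fk_finsler k. Qed.

Let Fk_gt0 k v : nonzero_part A v -> 0 < Fk k v.
Proof.
move=> /(@nonzero_sub k _)[Av v0].
rewrite lt_neqAle (cpf_ge0 (cFk k) Av) andbT eq_sym.
by apply/eqP => /(cpf_eq0 (cFk k) Av).
Qed.

(** The index [k0] exists because n >= 1, and its metric is positive off the zero vectors. This
    keeps the arguments of [L] where [L] is smooth and positive. *)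
Let star_neq0 v : nonzero_part A v -> star v <> 0.
Proof.
move=> /(Fk_gt0 k0) + v0.
by rewrite -star_l v0 mxE ltxx.
Qed.

Let star_eq0 v : A v -> tvec v = 0 -> star v = 0.
Proof.
case: v => p v Av /= v0; apply/rowP => r; rewrite [RHS]mxE.
case: (split_ordP r) => k ->.
  by rewrite star_l; apply/(cpf_eq0 (cFk k)) => //; exact: A_sub.
rewrite star_r v0.
have := linear_rowE 0 (one_form_linear (beta_form k) p).
by under eq_bigr do rewrite mxE mul0r; rewrite big1.
Qed.

Let starZ p v (l : R) : A (TVec p v) -> 0 < l ->
  star (TVec p (l *: v)) = l *: star (TVec p v).
Proof.
move=> Av l0; apply/rowP => r; rewrite [RHS]mxE.
case: (split_ordP r) => k ->.
  by rewrite !star_l; apply: (cpf_homo (cFk k)) => //; exact: A_sub.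
rewrite !star_r.
have := one_form_linear (beta_form k) p l v 0.
rewrite addr0 => ->; rewrite [X in _ + X](_ : _ = 0) ?addr0//.
have := linear_rowE 0 (one_form_linear (beta_form k) p).
by under eq_bigr do rewrite mxE mul0r; rewrite big1.
Qed.

Let L_star0 v : A v -> star v = 0 -> L (star_point Fk beta v) = 0.
Proof.
move=> /star_in[+ _]; rewrite [star_point _ _ _]surjective_pairing -/(star v).
move=> + v0; rewrite v0 => B0.
(* Scaling by 2 gives a = 4 a for the value a of [L] at the zero point, so a = 0. *)
have := L_homo (tproj v) (@ltr0Sn R 1) B0; rewrite scaler0.
set a := L _ => /eqP; rewrite -natrX mulr_natl mulrS -subr_eq0 opprD addrA.
by rewrite subrr sub0r oppr_eq0 mulrn_eq0 => /eqP.
Qed.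

Let L_star_gt0 v : nonzero_part A v -> 0 < L (star_point Fk beta v).
Proof.
move=> Av; have [Bv _] := star_in Av.1.
by rewrite [star_point _ _ _]surjective_pairing; apply/L_pos/star_neq0.
Qed.

Let L_star_ge0 v : A v -> 0 <= L (star_point Fk beta v).
Proof.
move=> Av; have [v0|v0] := pselect (tvec v = 0); last by apply/ltW/L_star_gt0.
by rewrite L_star0// star_eq0.
Qed.

Let A_open : tangent_open A.
Proof.
move=> i; rewrite openE => z [iz Az].
have nz : nbhs z (fun z => forall k, tcoords i (Ak k) z).
  apply: (@filter_forall _ _ (fun k => tcoords i (Ak k)) (nbhs z) _) => k.
  apply: open_nbhs_nbhs; split.
    exact: (cpf_open (cFk k)).
  by split=> //; exact: A_sub.
suff : nbhs z (tcoords i A) by [].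
apply: filterS nz => y Ay; split; first by have [] := Ay k0.
by rewrite A_def => k _; have [] := Ay k.
Qed.

(** Openness of being nonzero is borrowed from the metric of index [k0], since continuity of F is
    not yet established. *)
Let nonzero_open : tangent_open (nonzero_part A).
Proof.
move=> i.
have -> : tcoords i (nonzero_part A) =
    tcoords i A `&` tcoords i (nonzero_part (Ak k0)).
  apply/seteqP; split=> z.
    by move=> [iz Az]; split; split=> //; [exact: Az.1|exact: nonzero_sub].
  by move=> [[iz Az] [_ [_ z0]]]; split.
by apply: openI; [exact: A_open|exact: tangent_open_nonzero (cFk k0) i].
Qed.

Let star_smooth i r : smooth_on (tcoords i (nonzero_part A))
  (fun z => star (tchart_inv i z) 0 r : R^o).
Proof.
move=> k; case: (split_ordP r) => j ->.
  rewrite (_ : (fun z => _) = Fk j \o tchart_inv i); last first.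
    by rewrite funeqE => z; rewrite star_l.
  apply: Ck_on_sub (cpf_smooth (cFk j) i k) => z [iz Az].
  by split=> //; exact: nonzero_sub.
rewrite (_ : (fun z => _) = beta j \o tchart_inv i); last first.
  by rewrite funeqE => z; rewrite star_r.
by apply: Ck_on_sub (one_form_smooth (beta_form j) i k) => z [].
Qed.

Let F_smooth : tangent_smooth_on (nonzero_part A) F.
Proof.
move=> i k; apply: Ck_on_sqrt; first exact: nonzero_open.
  by move=> z [_]; exact: L_star_gt0.
(* In a chart, [L] also depends on the base coordinates [z.1], which therefore join the star point
   in the inner map. *)
pose G (z : 'rV[R]_d * 'rV[R]_d) :=
  0 + \sum_s pair_coord (star (tchart_inv i z)) z.1 s *: @pair_delta R _ d s.
have EG z : G z = (star (tchart_inv i z), z.1) by rewrite /G -pair_lincomb.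
pose Lh (x : 'rV[R]_(n + m) * 'rV[R]_d) : R^o := L (x.1, coord_inv i x.2).
refine (@Ck_on_eq R _ _ k _ (fun z => Lh (G z)) _ (nonzero_open (i := i)) _ _).
  by move=> z _; rewrite /Lh EG.
refine (@Ck_on_comp R _ _ k _ _ _ 0 (@pair_delta R _ d)
  (fun s z => pair_coord (star (tchart_inv i z)) z.1 s) Lh
  (nonzero_open (i := i)) _ _ (@L_smooth i k)).
- move=> z [iz Az]; rewrite -[X in mkset _ X]/(G z) EG; split => //=.
    by have [] := star_in Az.1.
  exact: star_neq0.
- by move=> [r|j]; [exact: star_smooth|exact: Ck_on_coord_fst].
Qed.

Let star_continuous i z : tcoords i A z ->
  {for z, continuous (star \o tchart_inv i)}.
Proof.
move=> [iz Az].
suff cr r : {for z, continuous (fun z => star (tchart_inv i z) 0 r : R^o)}.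
  have -> : star \o tchart_inv i =
      fun z => \sum_r star (tchart_inv i z) 0 r *: delta_mx 0 r.
    by rewrite funeqE => y; exact: row_sum_delta.
  apply: (@cvg_big _ _ +%R 0 predT (@add_continuous _) _ (nbhs z) _
    (fun r z => star (tchart_inv i z) 0 r *: delta_mx 0 r)) => // r _.
  by apply: cvgZr_tmp; exact: cr.
case: (split_ordP r) => j ->.
  rewrite (_ : (fun z => _) = Fk j \o tchart_inv i); last first.
    by rewrite funeqE => y; rewrite star_l.
  by apply: (cpf_continuous (cFk j)); split=> //; exact: A_sub.
rewrite (_ : (fun z => _) = beta j \o tchart_inv i); last first.
  by rewrite funeqE => y; rewrite star_r.
exact: (one_form_smooth (beta_form j) i 0%N z iz).
Qed.

(** Smoothness says nothing at the zero vectors of A; continuity there comes from that of [L] on the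
    open set B x M. *)
Let F_continuous : tangent_continuous_on A F.
Proof.
move=> i z Az; have [iz Atz] := Az.
have cs : {for z, continuous (star_point Fk beta \o tchart_inv i)}.
  have -> : star_point Fk beta \o tchart_inv i =
      fun z => ((star \o tchart_inv i) z, (coord_inv i \o fst) z).
    by rewrite funeqE => y; rewrite [LHS]surjective_pairing.
  have fst_cont : {for z, continuous (@fst 'rV[R]_d 'rV[R]_d)}.
    by case: z {Az iz Atz} => x y; exact: cvg_fst.
  exact: (@cvg_pair _ _ _ (nbhs z) (nbhs _) (nbhs _) _ _ _
    (star \o tchart_inv i) (coord_inv i \o fst) (star_continuous Az)
    (continuous_comp fst_cont (continuous_coord_inv iz))).
have oBM : open (B `*` [set: M]).
  rewrite (_ : B `*` setT = fst @^-1` B); last first.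
    by apply/seteqP; split=> x //= [].
  by apply: open_comp => // -[x y] _; exact: cvg_fst.
have cL : {for (star_point Fk beta \o tchart_inv i) z, continuous L}.
  have := L_cont; rewrite continuous_open_subspace// => /(_ _).
  by apply; rewrite in_setE; exact: star_in.
exact: continuous_comp (continuous_comp cs cL) (@sqrt_continuous R _).
Qed.

Lemma combination_pseudo_finsler : conic_pseudo_finsler A F.
Proof.
split=> //.
- move=> p v l Av l0; rewrite A_def => k _.
  by apply: (cpf_conic (cFk k)) => //; exact: A_sub.
- by move=> v _; exact: sqrtr_ge0.
- move=> v Av; split=> [|v0]; last first.
    by rewrite /F L_star0 ?sqrtr0// star_eq0.
  move=> Fv0; apply: contrapT => v0.
  have : 0 < F v by rewrite sqrtr_gt0; exact: L_star_gt0.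
  by rewrite Fv0 ltxx.
- move=> p v l Av l0; rewrite /F.
  have -> : star_point Fk beta (TVec p (l *: v)) =
      (l *: star (TVec p v), p).
    by rewrite -starZ// [LHS]surjective_pairing.
  rewrite L_homo//; last by have [] := star_in Av.
  by rewrite sqrtrM ?sqr_ge0// sqrtr_sqr gtr0_norm.
Qed.

(** * Second derivatives of F^2 on one tangent space *)

Section FundamentalTensor.
Variables (p : M) (v w : 'rV[R]_d).
Hypotheses (Av : A (TVec p v)) (v0 : v <> 0).
Let g r (u : 'rV[R]_d) : R^o := star (TVec p u) 0 r.
Let ell (x : 'rV[R]_(n + m)) : R^o := L (x, p).
Let B0 := [set x : 'rV[R]_(n + m) | B x /\ x <> 0].
Let q := star_point Fk beta (TVec p v).

Let U_open : open (fiber A p).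
Proof. exact: fiber_open combination_pseudo_finsler. Qed.

Let ell_smooth : Ck_on 2 B0 ell.
Proof.
have B0_open : open B0.
  have -> : B0 = B `&` (fun x : 'rV[R]_(n + m) => `|x|) @^-1` [set x | x != 0].
    by apply/seteqP; split=> x [Bx /=]; rewrite ?normr_eq0 => /eqP.
  apply: openI => //; apply: open_comp; last exact: open_neq.
  by move=> x _; exact: norm_continuous.
set i := chart_at p; set y := Defs.coord i p.
pose G (x : 'rV[R]_(n + m)) := 0 + \sum_s pair_coord x y s *: @pair_delta R _ d s.
have EG x : G x = (x, y) by rewrite /G -pair_lincomb.
pose Lh (x : 'rV[R]_(n + m) * 'rV[R]_d) : R^o := L (x.1, coord_inv i x.2).
refine (@Ck_on_eq R _ _ 2 _ (fun x => Lh (G x)) _ B0_open _ _).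
  by move=> x _; rewrite /Lh EG /= coord_inv_at.
refine (@Ck_on_comp R _ _ 2 _ _ _ 0 (@pair_delta R _ d)
  (fun s x => pair_coord x y s) Lh B0_open _ _ (@L_smooth i 2%N)).
- move=> x [Bx x0]; rewrite -[X in mkset _ X]/(G x) EG; split => //=.
  exact: chart_img_at.
- by move=> [r|j]; [exact: Ck_on_coord|exact: Ck_on_cst].
Qed.

Let g_l k : g (lshift m k) = fun u => Fk k (TVec p u).
Proof. by rewrite funeqE => u; exact: star_l. Qed.

Let g_r j : g (rshift n j) = fun u => beta j (TVec p u).
Proof. by rewrite funeqE => u; exact: star_r. Qed.

Let g_smooth r : Ck_on 2 (fiber A p) (g r).
Proof.
case: (split_ordP r) => k ->.
  rewrite g_l; apply: Ck_on_sub (@fiber_smooth _ _ _ _ _ p (cFk k) 2%N) => u.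
  exact: nonzero_sub.
have lb := one_form_linear (beta_form k) p.
by rewrite g_r; apply: Ck_on_linear => //; exact: linear_row_continuous.
Qed.

Let derive_g_r j : 'D_w (g (rshift n j)) = cst (beta j (TVec p w)).
Proof.
have lb := one_form_linear (beta_form j) p.
by rewrite g_r derive_linear//; exact: linear_row_continuous.
Qed.

(** This is the origin of P(v,w): the velocity of the star point as v moves in direction w. It turns
    the second-order terms in [L] into the Hessian form. *)
Let P_vectorE r : P_vector Fk beta p v w 0 r = 'D_w (g r) v.
Proof.
case: (split_ordP r) => k ->.
  rewrite row_mxEl mxE g_l (fundamental_tensor_radial (cFk k))//;
    last exact: A_sub.
  by rewrite mulrAC divff ?mul1r// gt_eqF// Fk_gt0.
by rewrite row_mxEr mxE -[RHS]/((fun u => 'D_w (g (rshift n k)) u) v) derive_g_r.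
Qed.

Lemma combination_fundamental_tensor : fundamental_tensor F p v w w =
  2^-1 * (\sum_(k < n) partial1 L (lshift m k) q / Fk k (TVec p v)
                       * angular_metric (Fk k) p v w)
  + 2^-1 * quad_form (hess L q) (P_vector Fk beta p v w).
Proof.
have Uv : fiber A p v by [].
pose G u := 0 + \sum_r g r u *: (delta_mx 0 r : 'rV[R]_(n + m)).
have EG u : G u = star (TVec p u) by rewrite /G add0r -row_sum_delta.
have GB u : fiber A p u -> B0 (G u).
  move=> Au; rewrite EG; split; last exact: star_neq0.
  by have [] := star_in Au.1.
have chain : 'D_w ('D_w (ell \o G)) v =
    \sum_r 'D_w ('D_w (g r)) v * 'D_(delta_mx 0 r) ell (G v)
    + \sum_r \sum_s 'D_w (g r) v * 'D_w (g s) v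
                      * 'D_(delta_mx 0 s) ('D_(delta_mx 0 r) ell) (G v).
  exact: derive2_comp_lincomb w U_open Uv GB g_smooth ell_smooth.
(* Two derivatives follow, so the square root must be removed near every point close to v, not only
   at v. *)
have E2 : \forall y \near v,
    'D_w (fun x => F (TVec p x) ^+ 2 : R^o) y = 'D_w (ell \o G) y.
  apply: filterS (open_nbhs_nbhs (conj U_open Uv)) => y Uy.
  apply: near_eq_derive; apply: filterS (open_nbhs_nbhs (conj U_open Uy)) => u Uu.
  by rewrite sqr_sqrtr ?L_star_ge0//; [rewrite /= EG|exact: Uu.1].
rewrite fundamental_tensorE (near_eq_derive _ E2) chain mulrDr.
have Gv : G v = star (TVec p v) by exact: EG.
congr (_ * _ + _ * _).
  rewrite big_split_ord /= [X in _ + X]big1 ?addr0 => [|j _]; last first.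
    by rewrite derive_g_r derive_cst mul0r.
  apply: eq_bigr => k _; rewrite g_l (angular_metricE (cFk k))//;
    last exact: A_sub.
  rewrite mulrA mulfVK ?gt_eqF ?Fk_gt0// mulrC.
  by rewrite Gv.
rewrite /quad_form mxE exchange_big; apply: eq_bigr => s _ /=.
rewrite [X in _ = X * _]mxE [X in _ = _ * X]mxE mulr_suml.
apply: eq_bigr => r _; rewrite !P_vectorE [hess _ _ _ _]mxE mulrAC.
by rewrite Gv.
Qed.
End FundamentalTensor.
End Combination.

Theorem theorem4p1 (R : realType) (d : nat) (M : manifold R d) (n m : nat)
  (n_ge1 : (1 <= n)%N)
  (Ak : 'I_n -> set (tangent_bundle M)) (Fk : 'I_n -> tangent_bundle M -> R)
  (Fk_finsler : forall k, conic_finsler (Ak k) (Fk k))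
  (beta : 'I_m -> tangent_bundle M -> R)
  (beta_form : forall j, one_form (beta j))
  (A : set (tangent_bundle M)) (A_def : A = \bigcap_k Ak k)
  (A_proj : @tproj R d M @` A = setT)
  (B : set 'rV[R]_(n + m)) (B_open : open B) (B_conic : conic_set B)
  (L : 'rV[R]_(n + m) * M -> R)
  (L_cont : {within B `*` setT, continuous L})
  (L_smooth : smooth_off_zero B L)
  (L_pos : forall x p, B x -> x <> 0 -> 0 < L (x, p))
  (L_homo : forall (l : R) x p, 0 < l -> B x ->
     L (l *: x, p) = l ^+ 2 * L (x, p))
  (star_in : forall v, A v -> (B `*` setT) (star_point Fk beta v))
  (F : tangent_bundle M -> R)
  (F_def : F = fun v => Num.sqrt (L (star_point Fk beta v))) :
  [/\ conic_pseudo_finsler A F,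
      (forall (p : M) (v w : 'rV[R]_d), A (TVec p v) -> v <> 0 ->
        let q := star_point Fk beta (TVec p v) in
        fundamental_tensor F p v w w =
          2^-1 * (\sum_(k < n) partial1 L (lshift m k) q / Fk k (TVec p v)
                               * angular_metric (Fk k) p v w)
          + 2^-1 * quad_form (hess L q) (P_vector Fk beta p v w)) &
      (forall v, nonzero_part A v ->
         (forall k : 'I_n,
            0 <= partial1 L (lshift m k) (star_point Fk beta v)) /\
         possemidef_mx (hess L (star_point Fk beta v))) ->
      fundamental_possemidef A F /\
      ((forall v, nonzero_part A v ->
          0 < \sum_(k < n) partial1 L (lshift m k) (star_point Fk beta v)) ->
       conic_finsler A F)].
Proof.
have Fk_gt0 k p v : A (TVec p v) -> v <> 0 -> 0 < Fk k (TVec p v).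
  rewrite A_def => /(_ k I) Av v0; have [cF _] := Fk_finsler k.
  rewrite lt_neqAle (cpf_ge0 cF Av) andbT eq_sym.
  by apply/eqP => /(cpf_eq0 cF Av).
have Ak_in k v : A v -> Ak k v by rewrite A_def => /(_ k I).
have cF : conic_pseudo_finsler A F.
  by rewrite F_def; exact: (combination_pseudo_finsler n_ge1 Fk_finsler
    beta_form A_def A_proj B_open L_cont L_smooth L_pos L_homo star_in).
have gE (p : M) (v w : 'rV[R]_d) : A (TVec p v) -> v <> 0 ->
    let q := star_point Fk beta (TVec p v) in
    fundamental_tensor F p v w w =
      2^-1 * (\sum_(k < n) partial1 L (lshift m k) q / Fk k (TVec p v)
                           * angular_metric (Fk k) p v w)
      + 2^-1 * quad_form (hess L q) (P_vector Fk beta p v w).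
  move=> Av v0; rewrite F_def.
  exact: (combination_fundamental_tensor n_ge1 Fk_finsler beta_form A_def A_proj
    B_open L_cont L_smooth L_pos L_homo star_in w Av v0).
split=> // semi.
have term_ge0 p v w k : A (TVec p v) -> v <> 0 ->
    0 <= partial1 L (lshift m k) (star_point Fk beta (TVec p v))
         / Fk k (TVec p v) * angular_metric (Fk k) p v w.
  move=> Av v0; have [Lk _] := semi (TVec p v) (conj Av v0).
  apply: mulr_ge0;
    last exact: (angular_metric_ge0 w (Fk_finsler k) (Ak_in k _ Av)).
  by rewrite divr_ge0// ltW// Fk_gt0.
have quad_ge0 p v w : A (TVec p v) -> v <> 0 ->
    0 <= quad_form (hess L (star_point Fk beta (TVec p v)))
           (P_vector Fk beta p v w).
  by move=> Av v0; have [_] := semi (TVec p v) (conj Av v0); exact.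
split=> [p v Av v0 w|pos].
  rewrite gE// -mulrDr mulr_ge0// addr_ge0 ?quad_ge0//.
  by apply: sumr_ge0 => k _; exact: term_ge0.
split=> // p v Av v0 w w0.
(* On the line of v every h^k_v vanishes and (C) gives nothing; Euler's identity for F itself takes
   over there. *)
have [[c wE]|wv] := pselect (exists c, w = c *: v).
  rewrite wE (fundamental_tensor_parallel cF)// -exprMn exprn_even_gt0//=.
  rewrite mulf_neq0//.
    by apply/eqP => c0; apply: w0; rewrite wE c0 scale0r.
  by apply/eqP => /(cpf_eq0 cF Av).
rewrite gE// -mulrDr mulr_gt0// ltr_wpDr ?quad_ge0//.
(* By (C) the L_k cannot all be nonpositive. One positive L_k suffices, as h^k_v(w,w) > 0 off the
   line of v and the other terms are nonnegative. *)
have [k Lk] : exists k : 'I_n,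
    0 < partial1 L (lshift m k) (star_point Fk beta (TVec p v)).
  apply: contrapT => Lk; have := pos (TVec p v) (conj Av v0).
  rewrite ltNge => /negP; apply; apply: sumr_le0 => k _.
  by rewrite leNgt; apply/negP => Lk0; apply: Lk; exists k.
rewrite (bigD1 k)//= ltr_pwDl ?sumr_ge0// => [|j _]; last exact: term_ge0.
rewrite mulr_gt0 ?divr_gt0 ?Fk_gt0//.
apply: (angular_metric_gt0 (Fk_finsler k) (Ak_in k _ Av)) => // c wE.
by apply: wv; exists c.
Qed.
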